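(* Let $p\in(0,1/2)$ and let $n\ge1$ be an integer. Let $S_j=X_1+\cdots+X_j$ be an asymmetric simple random walk, where $X_1,X_2,\ldots$ are i.i.d. with $\mathbf{P}_p(X_i=1)=p=1-\mathbf{P}_p(X_i=-1)$. Run the walk for at most $n$ steps; if $S_k\ge0$ for some $1\le k\le n$, output $1$; otherwise stop after $n$ steps and output $0$. Then the probability of outputting $1$ equals $2p-\varepsilon$, where $0\le\varepsilon\le2\exp\big(-2n(1/2-p)^2\big)$. *)

(* Defs.v *)
From HB Require Import structures.
From mathcomp Require Import all_boot all_order all_algebra finmap.
From mathcomp Require Import all_classical all_reals all_analysis.

Set Implicit Arguments.
Unset Strict Implicit.
Unset Printing Implicit Defensive.

Import Order.TTheory GRing.Theory Num.Theory.
Import numFieldNormedType.Exports.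

Local Open Scope classical_set_scope.
Local Open Scope ring_scope.

Section RandomWalk.
Context {d : measure_display} {T : measurableType d} {R : realType}.
Variable P : probability T R.

Definition mutually_independent (X : nat -> {RV P >-> R}) : Prop :=
  forall (J : {fset nat}) (A : nat -> set R),
    (forall i, i \in J -> measurable (A i)) ->
    P (\bigcap_(i in [set` J]) (X i @^-1` A i)) =
    (\prod_(i <- J) P (X i @^-1` A i))%E.

Definition identically_distributed (X : nat -> {RV P >-> R}) : Prop :=
  forall (i j : nat) (A : set R), measurable A ->
    distribution P (X i) A = distribution P (X j) A.

Definition iid (X : nat -> {RV P >-> R}) : Prop :=
  mutually_independent X /\ identically_distributed X.

(* Indices are shifted by one: [X i] is the step usually written X_{i+1},
   so that [walk X j] = S_j = X_1 + ... + X_j. *)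
Definition asymmetric_simple_steps (p : R) (X : nat -> {RV P >-> R}) : Prop :=
  iid X /\
  forall i, P (X i @^-1` [set 1]) = p%:E /\
            P (X i @^-1` [set -1]) = (1 - p)%:E.

Definition walk (X : nat -> {RV P >-> R}) (j : nat) (w : T) : R :=
  \sum_(i < j) X i w.

(* [iota 1 n] = 1, 2, ..., n *)
Definition walk_output (X : nat -> {RV P >-> R}) (n : nat) (w : T) : nat :=
  if has (fun k => 0 <= walk X k w) (iota 1 n) then 1%N else 0%N.

End RandomWalk.

(* Main.v *)
Require Import Defs.
From HB Require Import structures.
From mathcomp Require Import all_boot all_order all_algebra.
From mathcomp Require Import finmap.
From mathcomp Require Import all_classical all_reals all_analysis.
From mathcomp Require Import ring lra.

Import Order.TTheory GRing.Theory Num.Theory.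
Import numFieldNormedType.Exports.

Local Open Scope classical_set_scope.
Local Open Scope ring_scope.

(** Put q = 1 - p and let a_n(x), resp. b_n(x), be the probability that a walk
started at height x and stepping up with probability p, resp. q, stays
positive during n steps. The output is 0 exactly when S_1, ..., S_n are all
negative: the first step is -1 and the reflected walk, which steps up with
probability q, stays positive from height 1 for the other n - 1 steps, so this
event has probability q b_(n-1)(1) ([P_neg_between]).

A path and its mirror image have probabilities whose ratio is (p/q) to the
power of the displacement, and this gives
q^x b_n(x) = q^x - p^x + p^x a_n(x) ([stay_pos_swap]); the term q^x - p^x,
divided by q^x, is the probability of never reaching 0. At x = 1 the output
is 1 with probability 1 - (q - p + p a_(n-1)(1)) = 2p - eps, where
eps = p a_(n-1)(1) is the probability that S_1, ..., S_n are all positive.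

This eps is nonnegative, and it is small because the walk drifts downwards:
(q/p)^(x/2) times (2 sqrt(pq))^n dominates a_n(x) ([stay_pos_le]), whence
eps <= (2 sqrt(pq))^n / 2, and 4pq = 1 - 4 (1/2 - p)^2 is at most
exp(-4 (1/2 - p)^2) ([stay_pos1_le]). *)

(** * Staying positive: recursion, reflection and decay *)

Section Stay.
Context {R : comNzRingType}.

(** The probability that a walk started at height [x], with steps +1 and -1 of
respective probabilities [u] and [v], is positive at each of the times
0, ..., [n]; it is computed by conditioning on the first step. *)
Fixpoint stay_pos (u v : R) (n x : nat) : R :=
  if n is n'.+1 then
    if x is y.+1 then u * stay_pos u v n' x.+1 + v * stay_pos u v n' y else 0
  else (0 < x)%N%:R.

Lemma stay_pos0 (u v : R) n : stay_pos u v n 0 = 0.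
Proof. by case: n. Qed.

(** Exchanging the two step probabilities multiplies the weight of a path by
(q/p) to the power of its displacement, so [stay_pos q p n x] splits into the
harmonic part 1 - (p/q)^x and a multiple of [stay_pos p q n x]. Clearing
denominators, both sides satisfy the same recursion because
q^2 + p q = q and p^2 + p q = p. *)
Lemma stay_pos_swap (p q : R) n x : p + q = 1 ->
  q ^+ x * stay_pos q p n x = q ^+ x - p ^+ x + p ^+ x * stay_pos p q n x.
Proof.
move=> pq1; have -> : q = 1 - p by rewrite -pq1 addrC addKr.
elim: n x => [|n IHn] [|y] /=; rewrite ?expr0; try by ring.
transitivity ((1 - p) ^+ y.+2 * stay_pos (1 - p) p n y.+2 +
    p * (1 - p) * ((1 - p) ^+ y * stay_pos (1 - p) p n y)).
  by rewrite !exprS; ring.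
by rewrite !IHn !exprS; ring.
Qed.

End Stay.

Section Bound.
Context {R : realFieldType}.

Lemma stay_pos_ge0 (u v : R) n x : 0 <= u -> 0 <= v -> 0 <= stay_pos u v n x.
Proof.
move=> u0 v0; elim: n x => [|n IHn] [|y] //=.
by rewrite addr_ge0 // mulr_ge0.
Qed.

(** (t/s)^x (2 s t)^n satisfies the recursion of [stay_pos] exactly, since
s^2 (t/s) + t^2 (s/t) = 2 s t, and it dominates the initial value because
t/s >= 1. The factor s^x keeps the statement free of divisions. *)
Lemma stay_pos_le (s t : R) n x : 0 <= s <= t ->
  s ^+ x * stay_pos (s ^+ 2) (t ^+ 2) n x <= t ^+ x * (2 * s * t) ^+ n.
Proof.
move=> /andP[s0 st]; have t0 := le_trans s0 st.
elim: n x => [|n IHn] [|y] /=.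
- by rewrite mulr0 !expr0 mulr1.
- by rewrite expr0 !mulr1 lerXn2r.
- by rewrite mulr0 !mulr_ge0 ?exprn_ge0 ?mulr_ge0.
have -> : s ^+ y.+1 * (s ^+ 2 * stay_pos (s ^+ 2) (t ^+ 2) n y.+2 +
      t ^+ 2 * stay_pos (s ^+ 2) (t ^+ 2) n y) =
    s * (s ^+ y.+2 * stay_pos (s ^+ 2) (t ^+ 2) n y.+2) +
    s * t ^+ 2 * (s ^+ y * stay_pos (s ^+ 2) (t ^+ 2) n y).
  by rewrite !exprS; ring.
have -> : t ^+ y.+1 * (2 * s * t) ^+ n.+1 =
    s * (t ^+ y.+2 * (2 * s * t) ^+ n) +
    s * t ^+ 2 * (t ^+ y * (2 * s * t) ^+ n).
  by rewrite !exprS; ring.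
by rewrite lerD // ler_wpM2l // mulr_ge0 // exprn_ge0.
Qed.

End Bound.

(** The left-hand side is the probability that the first [n.+1] positions of
the walk are all positive. *)
Lemma stay_pos1_le (R : realType) (p : R) n : 0 < p < 1 / 2 ->
  p * stay_pos p (1 - p) n 1 <=
  expR (- (2 * n.+1%:R * (1 / 2 - p) ^+ 2)) / 2.
Proof.
move=> /andP[p0 p2].
set s := Num.sqrt p; set t := Num.sqrt (1 - p).
have s0 : 0 <= s by exact: sqrtr_ge0.
have t0 : 0 <= t by exact: sqrtr_ge0.
have ps : p = s ^+ 2 by rewrite sqr_sqrtr // ltW.
have qt : 1 - p = t ^+ 2 by rewrite sqr_sqrtr //; lra.
have st : s <= t by apply: ler_wsqrtr; lra.
apply: (@le_trans _ _ ((2 * s * t) ^+ n.+1 / 2)).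
  have := @stay_pos_le _ s t n 1; rewrite s0 st -ps -qt !expr1 => /(_ isT) h.
  have -> : (2 * s * t) ^+ n.+1 / 2 = s * (t * (2 * s * t) ^+ n).
    by rewrite exprS; field.
  by rewrite {1}ps expr2 -(mulrA s s) ler_wpM2l.
rewrite ler_wpM2r //.
have -> : - (2 * n.+1%:R * (1 / 2 - p) ^+ 2) =
    - (2 * (1 / 2 - p) ^+ 2) * n.+1%:R by ring.
rewrite expRM_natr lerXn2r ?nnegrE ?expR_ge0 ?mulr_ge0 //.
(* Squaring removes the roots: (2 s t)^2 = 4 p (1 - p) = 1 - 4 (1/2 - p)^2. *)
rewrite -(@ler_pXn2r _ 2) ?nnegrE ?expR_ge0 ?mulr_ge0 // -expRM_natr.
have -> : (2 * s * t) ^+ 2 = 1 + - (2 * (1 / 2 - p) ^+ 2) * 2%:R.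
  have -> : (2 * s * t) ^+ 2 = 4 * s ^+ 2 * t ^+ 2 by ring.
  by rewrite -ps -qt; field.
exact: expR_ge1Dx.
Qed.

(** * The law of the walk *)

Section Walk.
Context {d : measure_display} {T : measurableType d} {R : realType}.
Variables (P : probability T R) (p : R) (X : nat -> {RV P >-> R}).
Hypothesis Xp : asymmetric_simple_steps p X.

Definition step_value (b : bool) : R := if b then 1 else -1.
Definition step_prob (b : bool) : R := if b then p else 1 - p.
Definition step_event i b : set T := X i @^-1` [set step_value b].
(** The event that the first [size s] steps of the walk are those coded by
[s], with [true] for +1. *)
Definition cylinder (s : seq bool) : set T :=
  [set w | forall i, (i < size s)%N -> X i w = step_value (nth false s i)].
(** The walk is negative at the [n] times m, m + 1, ..., m + n - 1. *)
Definition neg_between m n : set T :=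
  [set w | all (fun k => walk X k w < 0) (iota m n)].

Lemma measurable_step_event i b : measurable (step_event i b).
Proof. by rewrite -[step_event _ _]setTI; exact: measurable_funP. Qed.

Lemma P_step_event i b : P (step_event i b) = (step_prob b)%:E.
Proof. by have [P1 PN1] := Xp.2 i; case: b. Qed.

Lemma step_event_disj i : step_event i true `&` step_event i false = set0.
Proof.
apply/seteqP; split=> w // [Xw1 XwN1].
have /eqP : (1 : R) = -1 := etrans (esym Xw1) XwN1.
by rewrite -subr_eq0 opprK -mulr2n pnatr_eq0.
Qed.

(** [measureU] stated for [P] as a probability, so that rewriting does not turn
[P] into the underlying content. *)
Lemma P_setU (A B : set T) : measurable A -> measurable B ->
  A `&` B = set0 -> P (A `|` B) = (P A + P B)%E.
Proof. exact: measureU. Qed.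

(** The two step events are disjoint and their probabilities p and 1 - p add up
to 1, so the other values of [X i] only occur on a null set. *)
Lemma measure_step_split (E : set T) i : measurable E ->
  P E = (P (E `&` step_event i true) + P (E `&` step_event i false))%E.
Proof.
move=> mE; set U := step_event i true `|` step_event i false.
have mU : measurable U by apply: measurableU; exact: measurable_step_event.
have PU : P U = 1%E.
  rewrite P_setU; [|exact: measurable_step_event..|exact: step_event_disj].
  by rewrite !P_step_event -EFinD /= addrC subrK.
have PUC : P (~` U) = 0%E by rewrite probability_setC // PU subee.
have PEC : P (E `&` ~` U) = 0%E.
  apply/eqP; rewrite eq_le measure_ge0 andbT -PUC le_measure ?inE //.
  - by apply: measurableI => //; exact: measurableC.
  - exact: measurableC.
have -> : P E = P (E `&` U).
  rewrite -{1}(setIT E) -(setUv U) setIUr P_setU ?PEC ?adde0 //.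
  - exact: measurableI.
  - by apply: measurableI => //; exact: measurableC.
  - by rewrite setIACA setICr setI0.
rewrite setIUr P_setU //.
- by apply: measurableI => //; exact: measurable_step_event.
- by apply: measurableI => //; exact: measurable_step_event.
- by rewrite setIACA step_event_disj setI0.
Qed.

Lemma cylinder_bigcap s :
  cylinder s = \bigcap_(i in [set` [fset i | i in iota 0 (size s)]%fset])
    (X i @^-1` [set step_value (nth false s i)]).
Proof.
apply/seteqP; split=> w /= h i /=.
  by rewrite !inE /= mem_iota add0n => /h.
by move=> si; apply: h; rewrite /= !inE /= mem_iota add0n.
Qed.

Lemma P_cylinder s : P (cylinder s) = (\prod_(b <- s) step_prob b)%:E.
Proof.
rewrite cylinder_bigcap Xp.1.1; last by move=> i _; exact: measurable_set1.
rewrite big_imfset //= undup_id ?iota_uniq // (big_nth false) /index_iota subn0 -prodEFin.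
by apply: eq_bigr => i _; rewrite P_step_event.
Qed.

Lemma measurable_cylinder s : measurable (cylinder s).
Proof.
rewrite cylinder_bigcap; apply: fin_bigcap_measurable => // i _.
Qed.

Lemma cylinder_rcons s b :
  cylinder (rcons s b) = cylinder s `&` step_event (size s) b.
Proof.
apply/seteqP; split=> w.
  move=> h; split=> [i si|].
    by have := h i; rewrite size_rcons nth_rcons si ltnS ltnW //; apply.
  by have := h (size s); rewrite size_rcons nth_rcons ltnn eqxx; apply.
move=> [h hs] i; rewrite size_rcons nth_rcons ltnS leq_eqVlt.
by case: ltngtP => //= [/h|->].
Qed.

Lemma walk_cylinder s w : cylinder s w ->
  walk X (size s) w = \sum_(b <- s) step_value b.
Proof.
move=> h; rewrite /walk (big_nth false) big_mkord.
by apply: eq_bigr => i _; exact: h.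
Qed.

Lemma measurable_neg_between m n : measurable (neg_between m n).
Proof.
elim: n m => [|n IHn] m.
  by rewrite (_ : neg_between m 0 = setT); [|exact/seteqP].
have -> : neg_between m n.+1 =
    (walk X m @^-1` `]-oo, 0[%classic) `&` neg_between m.+1 n.
  apply/seteqP; split=> w /=; rewrite /neg_between /= in_itv /=.
    by move=> /andP[].
  by move=> [-> ->].
apply: measurableI => //; rewrite -[X in measurable X]setTI.
have : measurable_fun setT (walk X m) by exact: measurable_sum.
by apply => //; exact: measurable_itv.
Qed.

(** Markov property at time [size s]: given the first steps [s], which lead to
-[x], the sign-reversed walk has to stay positive from height [x]. The interval of
times includes [size s] itself, so that both sides vanish when [x] is 0; this
lets the induction on [n] split on the next step without a case analysis on
whether that step reaches 0. *)
Lemma P_cylinder_neg s n x : \sum_(b <- s) step_value b = - x%:R ->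
  P (cylinder s `&` neg_between (size s) n.+1) =
  ((\prod_(b <- s) step_prob b) * stay_pos (1 - p) p n x)%:E.
Proof.
elim: n s x => [|n IHn] s [|x] sx.
(* At [x] = 0 the walk is not negative at time [size s]. *)
1,3: rewrite stay_pos0 mulr0 (_ : _ `&` _ = set0) ?measure0 //;
  apply/seteqP; split=> // w [/walk_cylinder sw];
  by rewrite /neg_between /= sw sx oppr0 ltxx.
  rewrite mulr1 -P_cylinder; congr (P _); apply/seteqP; split=> w; first by case.
  by move=> h; split=> //=; rewrite /neg_between /= (walk_cylinder _ _ h) sx oppr_lt0 ltr0n.
have cyl b : cylinder s `&` neg_between (size s) n.+2 `&` step_event (size s) b =
    cylinder (rcons s b) `&` neg_between (size (rcons s b)) n.+1.
  rewrite cylinder_rcons size_rcons setIAC; apply/seteqP.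
  split=> w [[h hb] hn]; split=> //; first by move: hn => /andP[].
  by apply/andP; split=> //; rewrite (walk_cylinder _ _ h) sx oppr_lt0 ltr0n.
rewrite (measure_step_split _ (size s)); last first.
  by apply: measurableI; [exact: measurable_cylinder|exact: measurable_neg_between].
rewrite !cyl (IHn _ x) ?(IHn _ x.+2); last 2 first.
- by rewrite big_rcons /= sx; rewrite -!natr1; ring.
- by rewrite big_rcons /= sx -natr1; ring.
by rewrite -EFinD !big_rcons /=; congr EFin; ring.
Qed.

Lemma P_neg_between n :
  P (neg_between 1 n.+1) = ((1 - p) * stay_pos (1 - p) p n 1)%:E.
Proof.
rewrite (measure_step_split _ 0); last exact: measurable_neg_between.
rewrite (_ : _ `&` step_event 0 true = set0) ?measure0 ?add0e; last first.
  apply/seteqP; split=> // w [/andP[+ _]].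
  by rewrite /walk big_ord1 => + /= e; rewrite e ltNge ler01.
have := @P_cylinder_neg [:: false] n 1; rewrite !big_seq1 /= => <- //.
rewrite setIC; congr (P (_ `&` _)); apply/seteqP; split=> w.
  by move=> h [].
by move=> /(_ 0%N); apply.
Qed.

Lemma walk_output_eq1 n :
  [set w | walk_output X n w = 1%N] = ~` neg_between 1 n.
Proof.
apply/seteqP; split=> w /=; rewrite /neg_between /walk_output /=.
  case: ifP => // /hasP[k kn k0] _ /allP /(_ _ kn).
  by rewrite ltNge k0.
move=> h; rewrite ifT //; apply: contra_notT h => /hasPn h.
by apply/allP => k /h; rewrite ltNge.
Qed.

End Walk.

(** * The output probability *)

Theorem mainTheorem6 (R : realType) (d : measure_display)
    (T : measurableType d) (P : probability T R) (p : R) (n : nat)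
    (X : nat -> {RV P >-> R}) :
  0 < p < 1 / 2 ->
  (1 <= n)%N ->
  asymmetric_simple_steps p X ->
  exists eps : R,
    P [set w | walk_output X n w = 1%N] = (2 * p - eps)%:E /\
    0 <= eps <= 2 * expR (- (2 * n%:R * (1 / 2 - p) ^+ 2)).
Proof.
move=> p012; case: n => // n _ Xp; have /andP[p0 p12] := p012.
exists (p * stay_pos p (1 - p) n 1); split.
  rewrite walk_output_eq1 probability_setC; last exact: measurable_neg_between.
  rewrite (P_neg_between P p X Xp) -EFinB; congr EFin.
  have := @stay_pos_swap _ p (1 - p) n 1; rewrite !expr1 => ->; last by ring.
  by ring.
rewrite mulr_ge0 ?stay_pos_ge0 ?(ltW p0) //=; last by lra.
apply: (le_trans (stay_pos1_le R p n p012)).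
set e := expR _; have : 0 <= e by exact: expR_ge0.
by lra.
Qed.
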